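(* Regard $UT_2$ as a $UT_2$-algebra with left and right actions given by the usual left and right multiplication. Then the generalized variety $\mathrm{gvar}(UT_2)$ of $UT_2$-algebras generated by $UT_2$ does not have almost polynomial growth of the codimensions.
   Context: $F$ is a field of characteristic zero; all algebras are associative $F$-algebras. $UT_2$ is the algebra of $2\times 2$ upper triangular matrices over $F$, with matrix units $e_{ij}$ and basis $\{1=e_{11}+e_{22},\,e_{22},\,e_{12}\}$. Put $W=UT_2$. A $W$-algebra is an algebra $A$ that is a (unital) $W$-bimodule such that $w(a_1a_2)=(wa_1)a_2$, $(a_1a_2)w=a_1(a_2w)$, $(a_1w)a_2=a_1(wa_2)$ for all $w\in W$, $a_1,a_2\in A$. The free $W$-algebra $W\langle X\rangle$ on $X=\{x_1,x_2,\dots\}$ has as $F$-basis the words $w_{0}x_{j_1}w_{1}x_{j_2}\cdots w_{n-1}x_{j_n}w_{n}$, $n\ge 1$, with $w_0,\dots,w_n$ in the basis $\{1,e_{22},e_{12}\}$ of $W$ ($x_i=1x_i=x_i1$), with juxtaposition product and expansion of products of adjacent coefficients in the basis of $W$. For a $W$-algebra $A$, $\mathrm{GId}(A)$ is the set of $f(x_1,\dots,x_n)\in W\langle X\rangle$ with $f(a_1,\dots,a_n)=0$ for all $a_i\in A$. $GP_n$ is the $F$-span of the elements $w_{0}x_{\sigma(1)}w_{1}\cdots w_{n-1}x_{\sigma(n)}w_{n}$, with $\sigma\in S_n$ and $w_i\in W$, and $gc_n(A)=\dim_F GP_n/(GP_n\cap\mathrm{GId}(A))$. $\mathrm{gvar}(A)$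 is the variety of $W$-algebras generated by $A$, i.e. the class of all $W$-algebras $B$ with $\mathrm{GId}(A)\subseteq\mathrm{GId}(B)$. For $\mathcal V=\mathrm{gvar}(A)$ put $\mathrm{GId}(\mathcal V)=\mathrm{GId}(A)$ and $gc_n(\mathcal V)=gc_n(A)$. $\mathcal V$ has polynomial growth if $gc_n(\mathcal V)$, $n\ge1$, is polynomially bounded; it has almost polynomial growth if $gc_n(\mathcal V)$ is not polynomially bounded but every proper generalized subvariety of $\mathcal V$ has polynomial growth. *)

(* Defs.v *)
From HB Require Import structures.
From mathcomp Require Import all_boot all_order all_algebra all_fingroup.
From mathcomp Require Import finmap.
From mathcomp.multinomials Require Import monalg.
From mathcomp Require Import mathcomp_extra boolp classical_sets.

Set Implicit Arguments.
Unset Strict Implicit.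
Unset Printing Implicit Defensive.

Import GRing.Theory.
Local Open Scope classical_set_scope.
Local Open Scope ring_scope.

Section UpperTriangular.
Variable F : fieldType.

Definition ut2_pred : {pred 'M[F]_2} := fun M => M 1 0 == 0.

Lemma ut2_subalg_closed : subalg_closed ut2_pred.
Proof.
split=> [|a u v /eqP u0 /eqP v0|u v /eqP u0 /eqP v0].
- by apply/eqP; rewrite mxE.
- by apply/eqP; rewrite !mxE u0 v0 mulr0 addr0.
- apply/eqP; rewrite mxE big_ord_recl big_ord1.
  by rewrite u0 mul0r add0r [lift _ _](_ : _ = 1) ?v0 ?mulr0 //; exact/val_inj.
Qed.

HB.instance Definition _ :=
  GRing.isSubalgClosed.Build F 'M[F]_2 ut2_pred ut2_subalg_closed.

Record ut2 := UT2 { ut2_val :> 'M[F]_2; ut2P : ut2_val \in ut2_pred }.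

HB.instance Definition _ := [isSub for ut2_val].
HB.instance Definition _ := [Choice of ut2 by <:].
HB.instance Definition _ := [SubChoice_isSubAlgebra of ut2 by <:].

Lemma delta_ut2 (i : 'I_2) : delta_mx i 1 \in ut2_pred.
Proof. by apply/eqP; rewrite mxE andbF. Qed.

Definition e12 : ut2 := UT2 (delta_ut2 0).
Definition e22 : ut2 := UT2 (delta_ut2 1).

Definition wbase (k : 'I_3) : ut2 := [tuple 1; e22; e12]`_k.

(* [M = M_11 * 1 + (M_22 - M_11) * e22 + M_12 * e12] *)
Definition wcoord (k : 'I_3) (M : ut2) : F :=
  [tuple M 0 0; M 1 1 - M 0 0; M 0 1]`_k.

Lemma wcoordK (M : ut2) : \sum_k wcoord k M *: wbase k = M.
Proof.
rewrite !big_ord_recl big_ord0 addr0; apply/val_inj => /=.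
apply/matrixP=> i j; rewrite !mxE.
have [->|->] : i = 0 \/ i = 1.
  by case: i => [[|[|]]] // ?; [left|right]; apply/val_inj.
- have [->|->] : j = 0 \/ j = 1.
    by case: j => [[|[|]]] // ?; [left|right]; apply/val_inj.
  + by rewrite /= !mulr0 !addr0 mulr1.
  + by rewrite /= !mulr0 !add0r mulr1.
- have [->|->] : j = 0 \/ j = 1.
    by case: j => [[|[|]]] // ?; [left|right]; apply/val_inj.
  + by rewrite /= !mulr0 !addr0 (eqP (ut2P M)).
  + by rewrite /= !mulr0 !mulr1 addr0 addrC subrK.
Qed.

Lemma wcoord_is_linear k : linear_for *%R (wcoord k).
Proof.
move=> a M N; rewrite /wcoord.
have E i j : ((a *: M + N : ut2) : 'M_2) i j = a * M i j + N i j.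
  by rewrite /= !mxE.
case: k => [[|[|[|]]]] //= _; rewrite !E //.
by rewrite opprD addrACA mulrBr.
Qed.

HB.instance Definition _ k :=
  GRing.isLinear.Build F ut2 F *%R (wcoord k) (wcoord_is_linear k).

End UpperTriangular.

(* An associative, not necessarily unital, [F]-algebra with a compatible unital
   [UT_2]-bimodule structure. *)
HB.mixin Record Lmodule_isWAlgebra (F : fieldType) A of GRing.Lmodule F A := {
  wmul : A -> A -> A;
  lact : ut2 F -> A -> A;
  ract : A -> ut2 F -> A;
  wmul_linearr : forall a, linear (wmul a);
  wmul_linearl : forall a, linear (wmul ^~ a);
  wmulA : associative wmul;
  lact_linearr : forall w, linear (lact w);
  lact_linearl : forall a, linear (lact ^~ a);
  ract_linearl : forall w, linear (ract ^~ w);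
  ract_linearr : forall a, linear (ract a);
  lact1 : forall a, lact 1 a = a;
  ract1 : forall a, ract a 1 = a;
  lactM : forall w w' a, lact (w * w') a = lact w (lact w' a);
  ractM : forall a w w', ract a (w * w') = ract (ract a w) w';
  lractA : forall w a w', ract (lact w a) w' = lact w (ract a w');
  lact_mul : forall w a b, lact w (wmul a b) = wmul (lact w a) b;
  ract_mul : forall a b w, ract (wmul a b) w = wmul a (ract b w);
  mul_ract_lact : forall a w b, wmul (ract a w) b = wmul a (lact w b)
}.

#[short(type="walgType")]
HB.structure Definition WAlgebra (F : fieldType) :=
  {A of Lmodule_isWAlgebra F A & GRing.Lmodule F A}.

Lemma linear_lc (F : fieldType) (U V : lmodType F) (g : U -> V) (I : Type)
    (r : seq I) (c : I -> F) (v : I -> U) :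
  linear g -> g (\sum_(i <- r) c i *: v i) = \sum_(i <- r) c i *: g (v i).
Proof.
move=> lg; have g0 : g 0 = 0.
  by have := lg (-1) 0 0; rewrite scaler0 addr0 scaleN1r addNr.
by elim: r => [|i r IHr]; rewrite ?big_nil // !big_cons lg IHr.
Qed.

Lemma linear_comp (F : fieldType) (U V E : lmodType F) (g : V -> E)
    (h : U -> V) : linear g -> linear h -> linear (fun x => g (h x)).
Proof. by move=> lg lh a x y; rewrite lh lg. Qed.

Section UT2WAlgebra.
Variable F : fieldType.
Implicit Types u v w : ut2 F.

Fact ut2_mul_linearr u : linear ( *%R u).
Proof. by move=> a v w; rewrite mulrDr scalerAr. Qed.

Fact ut2_mul_linearl u : linear ( *%R ^~ u).
Proof. by move=> a v w; rewrite mulrDl scalerAl. Qed.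

HB.instance Definition _ := Lmodule_isWAlgebra.Build F (ut2 F)
  ut2_mul_linearr ut2_mul_linearl (@mulrA _)
  ut2_mul_linearr ut2_mul_linearl ut2_mul_linearl ut2_mul_linearr
  (@mul1r _) (@mulr1 _)
  (fun u v w => esym (mulrA u v w)) (@mulrA _)
  (fun u v w => esym (mulrA u v w))
  (@mulrA _) (fun u v w => esym (mulrA u v w))
  (fun u v w => esym (mulrA u v w)).

End UT2WAlgebra.

(** [wmonom a [:: (w_0, j_1); ...; (w_(n-1), j_n)] w_n] is the product
    [w_0 a_(j_1) w_1 a_(j_2) ... w_(n-1) a_(j_n) w_n]; the empty list, which
    corresponds to no product of elements of [A], gives [0]. *)
Fixpoint wmonom (F : fieldType) (A : walgType F) (a : nat -> A)
    (l : seq (ut2 F * nat)) (wn : ut2 F) : A :=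
  match l with
  | [::] => 0
  | [:: p] => ract (lact p.1 (a p.2)) wn
  | p :: l' => wmul (lact p.1 (a p.2)) (wmonom a l' wn)
  end.

Section FreeWAlgebra.
Variable F : fieldType.

(* [(w_0, j_1, [:: (w_1, j_2); ...; (w_(n-1), j_n)], w_n)] encodes the word
   [w_0 x_(j_1) w_1 x_(j_2) ... w_(n-1) x_(j_n) w_n], where each [w_i] is given
   by its index in [wbase]. *)
Definition word : Type := 'I_3 * nat * seq ('I_3 * nat) * 'I_3.

HB.instance Definition _ := Choice.on word.

Definition wfree := {malg F[word]}.

HB.instance Definition _ := GRing.Lmodule.on wfree.

Definition base_word (t : word) : wfree := << t >>.

Definition lext (V : lmodType F) (g : word -> V) (f : wfree) : V :=
  \sum_(t <- msupp f) f@_t *: g t.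

Lemma lextEw (V : lmodType F) (g : word -> V) (f : wfree) (d : {fset word}) :
  (msupp f `<=` d)%fset -> lext g f = \sum_(t <- d) f@_t *: g t.
Proof.
move=> sub; rewrite /lext (big_fset_incl _ sub) // => t _ /mcoeff_outdom ->.
by rewrite scale0r.
Qed.

Lemma lext_is_linear (V : lmodType F) (g : word -> V) : linear (lext g).
Proof.
move=> a f h; pose d := (msupp f `|` msupp h)%fset.
rewrite (@lextEw _ g f d) ?fsubsetUl // (@lextEw _ g h d) ?fsubsetUr //.
rewrite (@lextEw _ g _ d); last first.
  by rewrite (fsubset_trans (msuppD_le _ _)) // fsetSU // msuppZ_le.
rewrite scaler_sumr -big_split; apply: eq_bigr => t _ /=.
by rewrite mcoeffD mcoeffZ scalerDl scalerA.
Qed.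

HB.instance Definition _ (V : lmodType F) (g : word -> V) :=
  GRing.isLinear.Build F wfree V _ (lext g) (@lext_is_linear V g).

Lemma lext_base (V : lmodType F) (g : word -> V) t : lext g (base_word t) = g t.
Proof. by rewrite /lext msuppU oner_eq0 big_seq_fset1 mcoeffUU scale1r. Qed.

Lemma wfree_ext (V : lmodType F) (g h : wfree -> V) :
  linear g -> linear h -> (forall t, g (base_word t) = h (base_word t)) ->
  forall f, g f = h f.
Proof.
move=> lg lh gh f.
have -> : f = \sum_(t <- msupp f) f@_t *: base_word t.
  rewrite {1}(monalgE f); apply: eq_bigr => t _.
  by apply/malgP=> k; rewrite mcoeffZ !mcoeffU mulr_natr.
by rewrite !linear_lc //; apply: eq_bigr => t _; rewrite gh.
Qed.

(* Products of adjacent coefficients are expanded in the basis of [UT_2]. *)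
Definition wfree_lact (w : ut2 F) : wfree -> wfree := lext (fun t =>
  let: (c, j, s, d) := t in
  \sum_e wcoord e (w * wbase F c) *: base_word (e, j, s, d)).

Definition wfree_ract (f : wfree) (w : ut2 F) : wfree := lext (fun t =>
  let: (p, s, d) := t in
  \sum_e wcoord e (wbase F d * w) *: base_word (p, s, e)) f.

Definition wfree_mul (f g : wfree) : wfree := lext (fun t => lext (fun u =>
  let: (p, s, d) := t in let: (c, j, s', d') := u in
  \sum_e wcoord e (wbase F d * wbase F c) *:
    base_word (p, s ++ (e, j) :: s', d')) g) f.

Lemma lext_fun_linear (V : lmodType F) a (g h : word -> V) f :
  lext (fun t => a *: g t + h t) f = a *: lext g f + lext h f.
Proof.
rewrite /lext scaler_sumr -big_split; apply: eq_bigr => t _ /=.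
by rewrite scalerDr !scalerA mulrC.
Qed.

Lemma ut2_ext (V : lmodType F) (g h : ut2 F -> V) :
  linear g -> linear h -> (forall k, g (wbase F k) = h (wbase F k)) ->
  forall w, g w = h w.
Proof.
move=> lg lh gh w; rewrite -(wcoordK w) !linear_lc //.
by apply: eq_bigr => k _; rewrite gh.
Qed.

Lemma wcoord_base e k : wcoord e (wbase F k) = (e == k)%:R.
Proof.
by case: e k => [[|[|[|]]]] //= ? [[|[|[|]]]] //= ?;
  rewrite /wcoord /wbase /= !mxE //= ?subrr ?subr0.
Qed.

(* the element [v x_j s u] for arbitrary outer coefficients [v] and [u] *)
Definition gword (v : ut2 F) j s (u : ut2 F) : wfree :=
  \sum_e \sum_d (wcoord e v * wcoord d u) *: base_word (e, j, s, d).

Lemma gword_linearl j s u : linear (fun v => gword v j s u).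
Proof.
move=> a v w; rewrite /gword scaler_sumr -big_split; apply: eq_bigr => e _ /=.
rewrite scaler_sumr -big_split; apply: eq_bigr => d _ /=.
by rewrite linearP scalerA -scalerDl mulrDl mulrA.
Qed.

Lemma gword_linearr v j s : linear (gword v j s).
Proof.
move=> a u w; rewrite /gword scaler_sumr -big_split; apply: eq_bigr => e _ /=.
rewrite scaler_sumr -big_split; apply: eq_bigr => d _ /=.
by rewrite linearP scalerA -scalerDl mulrDr mulrCA.
Qed.

Lemma gwordEl v j s d :
  gword v j s (wbase F d) = \sum_e wcoord e v *: base_word (e, j, s, d).
Proof.
apply: eq_bigr => e _; rewrite (bigD1 d) //= big1 ?addr0.
  by rewrite wcoord_base eqxx mulr1.
by move=> d' /negPf nd; rewrite wcoord_base nd mulr0 scale0r.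
Qed.

Lemma gwordEr c j s u :
  gword (wbase F c) j s u = \sum_e wcoord e u *: base_word (c, j, s, e).
Proof.
rewrite /gword (bigD1 c) //=.
rewrite [X in _ + X]big1 => [|c' /negPf nc].
  by rewrite addr0; apply: eq_bigr => d _; rewrite wcoord_base eqxx mul1r.
by apply: big1 => d _; rewrite wcoord_base nc mul0r scale0r.
Qed.

Lemma base_wordE c j s d :
  base_word (c, j, s, d) = gword (wbase F c) j s (wbase F d).
Proof.
rewrite gwordEr (bigD1 d) //= big1 ?addr0.
  by rewrite wcoord_base eqxx scale1r.
by move=> d' /negPf nd; rewrite wcoord_base nd scale0r.
Qed.

Lemma wfree_lact_linearr w : linear (wfree_lact w).
Proof. exact: lext_is_linear. Qed.

Lemma wfree_lact_linearl f : linear (wfree_lact ^~ f).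
Proof.
move=> a v w; rewrite /wfree_lact -lext_fun_linear /lext.
apply: eq_bigr => -[[[c j] s] d] _; congr (_ *: _).
rewrite scaler_sumr -big_split; apply: eq_bigr => e _ /=.
by rewrite mulrDl -scalerAl linearP scalerA -scalerDl.
Qed.

Lemma wfree_ract_linearl w : linear (wfree_ract ^~ w).
Proof. exact: lext_is_linear. Qed.

Lemma wfree_ract_linearr f : linear (wfree_ract f).
Proof.
move=> a v w; rewrite /wfree_ract -lext_fun_linear /lext.
apply: eq_bigr => -[[[c j] s] d] _; congr (_ *: _).
rewrite scaler_sumr -big_split; apply: eq_bigr => e _ /=.
by rewrite mulrDr -scalerAr linearP scalerA -scalerDl.
Qed.

Lemma wfree_mul_linearl g : linear (wfree_mul ^~ g).
Proof. exact: lext_is_linear. Qed.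

Lemma wfree_mul_linearr f : linear (wfree_mul f).
Proof.
move=> a g h; rewrite /wfree_mul -lext_fun_linear /lext.
by apply: eq_bigr => t _; congr (_ *: _); exact: lext_is_linear.
Qed.

Lemma wfree_mul_suml (I : finType) (c : I -> F) (z : I -> wfree) g :
  wfree_mul (\sum_i c i *: z i) g = \sum_i c i *: wfree_mul (z i) g.
Proof. exact: (linear_lc _ _ _ (wfree_mul_linearl g)). Qed.

Lemma wfree_mul_sumr (I : finType) (c : I -> F) (z : I -> wfree) f :
  wfree_mul f (\sum_i c i *: z i) = \sum_i c i *: wfree_mul f (z i).
Proof. exact: (linear_lc _ _ _ (wfree_mul_linearr f)). Qed.

Lemma wfree_lactE w v j s u :
  wfree_lact w (gword v j s u) = gword (w * v) j s u.
Proof.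
move: u; apply: ut2_ext => [a x y|a x y|d]; rewrite ?gword_linearr //.
  by rewrite wfree_lact_linearr.
move: v; apply: ut2_ext => [a x y|a x y|c].
- by rewrite gword_linearl wfree_lact_linearr.
- by rewrite mulrDr -scalerAr gword_linearl.
- by rewrite -base_wordE /wfree_lact lext_base gwordEl.
Qed.

Lemma wfree_ractE w v j s u :
  wfree_ract (gword v j s u) w = gword v j s (u * w).
Proof.
move: v; apply: ut2_ext => [a x y|a x y|c]; rewrite ?gword_linearl //.
  by rewrite wfree_ract_linearl.
move: u; apply: ut2_ext => [a x y|a x y|d].
- by rewrite gword_linearr wfree_ract_linearl.
- by rewrite mulrDl -scalerAl gword_linearr.
- by rewrite -base_wordE /wfree_ract lext_base gwordEr.
Qed.

Lemma wfree_mulE v j s u v' j' s' u' :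
  wfree_mul (gword v j s u) (gword v' j' s' u') =
  \sum_e wcoord e (u * v') *: gword v j (s ++ (e, j') :: s') u'.
Proof.
pose r x v u' : wfree :=
  \sum_e wcoord e x *: gword v j (s ++ (e, j') :: s') u'.
rewrite -[RHS]/(r (u * v') v u').
have r1 v0 u0 : linear (fun x => r x v0 u0).
  move=> a x y; rewrite /r scaler_sumr -big_split; apply: eq_bigr => e _ /=.
  by rewrite linearP scalerDl scalerA.
have r2 x u0 : linear (fun z => r x z u0).
  move=> a z y; rewrite /r scaler_sumr -big_split; apply: eq_bigr => e _ /=.
  by rewrite gword_linearl scalerDr !scalerA mulrC.
have r3 x v0 : linear (fun z => r x v0 z).
  move=> a z y; rewrite /r scaler_sumr -big_split; apply: eq_bigr => e _ /=.
  by rewrite gword_linearr scalerDr !scalerA mulrC.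
move: v; apply: ut2_ext => [a x y|a x y|c].
- by rewrite gword_linearl wfree_mul_linearl.
- exact: r2.
move: u'; apply: ut2_ext => [a x y|a x y|d'].
- by rewrite gword_linearr wfree_mul_linearr.
- exact: r3.
move: u; apply: ut2_ext => [a x y|a x y|d].
- by rewrite gword_linearr wfree_mul_linearl.
- by rewrite mulrDl -scalerAl; exact: r1.
move: v'; apply: ut2_ext => [a x y|a x y|c'].
- by rewrite gword_linearl wfree_mul_linearr.
- by rewrite mulrDr -scalerAr; exact: r1.
rewrite -!base_wordE /wfree_mul !lext_base.
by apply: eq_bigr => e _; rewrite base_wordE.
Qed.

Lemma wfree_ext_gword (V : lmodType F) (g h : wfree -> V) :
  linear g -> linear h ->
  (forall v j s u, g (gword v j s u) = h (gword v j s u)) ->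
  forall f, g f = h f.
Proof.
by move=> lg lh gh; apply: wfree_ext => // -[[[c j] s] d]; rewrite base_wordE.
Qed.

Let lin := (wfree_lact_linearr, wfree_ract_linearl, wfree_mul_linearl,
  wfree_mul_linearr).

Fact wfree_lact1 f : wfree_lact 1 f = f.
Proof.
move: f; apply: wfree_ext_gword => [a f g|a f g|v j s u].
- by rewrite ?lin.
- by rewrite ?lin.
by rewrite ?wfree_lactE ?mul1r.
Qed.

Fact wfree_ract1 f : wfree_ract f 1 = f.
Proof.
move: f; apply: wfree_ext_gword => [a f g|a f g|v j s u].
- by rewrite ?lin.
- by rewrite ?lin.
by rewrite ?wfree_ractE ?mulr1.
Qed.

Fact wfree_lactM w w' f : wfree_lact (w * w') f = wfree_lact w (wfree_lact w' f).
Proof.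
move: f; apply: wfree_ext_gword => [a f g|a f g|v j s u].
- by rewrite ?lin.
- by rewrite ?lin.
by rewrite ?wfree_lactE ?mulrA.
Qed.

Fact wfree_ractM f w w' : wfree_ract f (w * w') = wfree_ract (wfree_ract f w) w'.
Proof.
move: f; apply: wfree_ext_gword => [a f g|a f g|v j s u].
- by rewrite ?lin.
- by rewrite ?lin.
by rewrite ?wfree_ractE ?mulrA.
Qed.

Fact wfree_lractA w f w' :
  wfree_ract (wfree_lact w f) w' = wfree_lact w (wfree_ract f w').
Proof.
move: f; apply: wfree_ext_gword => [a f g|a f g|v j s u].
- by rewrite ?lin.
- by rewrite ?lin.
by rewrite ?(wfree_lactE, wfree_ractE).
Qed.

Fact wfree_lact_mul w f g : wfree_lact w (wfree_mul f g) = wfree_mul (wfree_lact w f) g.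
Proof.
move: f; apply: wfree_ext_gword => [a x y|a x y|v j s u].
- by rewrite !lin.
- by rewrite !lin.
move: g; apply: wfree_ext_gword => [a x y|a x y|v' j' s' u'].
- by rewrite !lin.
- by rewrite !lin.
rewrite wfree_lactE !wfree_mulE.
rewrite linear_lc; last exact: wfree_lact_linearr.
by apply: eq_bigr => e _; rewrite wfree_lactE.
Qed.

Fact wfree_ract_mul f g w : wfree_ract (wfree_mul f g) w = wfree_mul f (wfree_ract g w).
Proof.
move: f; apply: wfree_ext_gword => [a x y|a x y|v j s u].
- by rewrite !lin.
- by rewrite !lin.
move: g; apply: wfree_ext_gword => [a x y|a x y|v' j' s' u'].
- by rewrite !lin.
- by rewrite !lin.
rewrite wfree_ractE !wfree_mulE.
rewrite (linear_lc _ _ _ (wfree_ract_linearl _)).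
by apply: eq_bigr => e _; rewrite wfree_ractE.
Qed.

Fact wfree_mul_ract_lact f w g :
  wfree_mul (wfree_ract f w) g = wfree_mul f (wfree_lact w g).
Proof.
move: f; apply: wfree_ext_gword => [a x y|a x y|v j s u].
- by rewrite !lin.
- by rewrite !lin.
move: g; apply: wfree_ext_gword => [a x y|a x y|v' j' s' u'].
- by rewrite !lin.
- by rewrite !lin.
by rewrite wfree_lactE wfree_ractE !wfree_mulE mulrA.
Qed.

Fact wfree_mulA : associative wfree_mul.
Proof.
move=> f g h.
move: f; apply: wfree_ext_gword => [a x y|a x y|v j s u].
- by rewrite !lin.
- by rewrite !lin.
move: g; apply: wfree_ext_gword => [a x y|a x y|v' j' s' u'].
- by rewrite !lin.
- by rewrite !lin.
move: h; apply: wfree_ext_gword => [| |v2 j2 s2 u2].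
- exact: (linear_comp (wfree_mul_linearr _) (wfree_mul_linearr _)).
- exact: wfree_mul_linearr.
have := wfree_mulE; have := wfree_mul_suml; have := wfree_mul_sumr.
generalize gword wfree_mul => G m m_sumr m_suml mE.
rewrite !mE m_suml m_sumr.
under eq_bigr do rewrite mE scaler_sumr.
under [RHS]eq_bigr do rewrite mE scaler_sumr.
rewrite [LHS]exchange_big.
apply: eq_bigr => e _.
apply: eq_bigr => d _.
by rewrite !scalerA mulrC -catA.
Qed.

HB.instance Definition _ := Lmodule_isWAlgebra.Build F wfree
  wfree_mul_linearr wfree_mul_linearl wfree_mulA
  wfree_lact_linearr wfree_lact_linearl wfree_ract_linearl wfree_ract_linearr
  wfree_lact1 wfree_ract1 wfree_lactM wfree_ractM wfree_lractA
  wfree_lact_mul wfree_ract_mul wfree_mul_ract_lact.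

Definition wvar (i : nat) : wfree := base_word (ord0, i, [::], ord0).

End FreeWAlgebra.

Section Evaluation.
Variables (F : fieldType) (A : walgType F).
Implicit Types (a : nat -> A) (w v u : ut2 F) (l : seq (ut2 F * nat)).

Definition word_coeffs (s : seq ('I_3 * nat)) : seq (ut2 F * nat) :=
  [seq (wbase F p.1, p.2) | p <- s].

(* [weval a f] is [f(a_0, a_1, ...)]; by [weval_unique] below it is the only
   morphism of [UT_2]-algebras from [wfree F] to [A] mapping [x_i] to [a_i]. *)
Definition weval a : wfree F -> A := lext (fun t =>
  let: (p, s, d) := t in wmonom a (word_coeffs (p :: s)) (wbase F d)).

Lemma weval_is_linear a : linear (weval a).
Proof. exact: lext_is_linear. Qed.

Lemma wmonom_cons a p q l u :
  wmonom a (p :: q :: l) u = wmul (lact p.1 (a p.2)) (wmonom a (q :: l) u).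
Proof. by []. Qed.

Lemma lact_wmonom a w v j l u :
  lact w (wmonom a ((v, j) :: l) u) = wmonom a ((w * v, j) :: l) u.
Proof.
by case: l => [|q l] /=; rewrite lactM; [rewrite -lractA | rewrite lact_mul].
Qed.

Lemma ract_wmonom a p l u w :
  ract (wmonom a (p :: l) u) w = wmonom a (p :: l) (u * w).
Proof.
elim: l p => [|q l IHl] p; first by rewrite /= ractM.
by rewrite !wmonom_cons ract_mul IHl.
Qed.

Lemma wmul_wmonom a p l u v j l' u' :
  wmul (wmonom a (p :: l) u) (wmonom a ((v, j) :: l') u') =
  wmonom a (p :: l ++ (u * v, j) :: l') u'.
Proof.
elim: l p => [|q l IHl] p.
  by rewrite [LHS]mul_ract_lact lact_wmonom.
by rewrite wmonom_cons -wmulA IHl.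
Qed.

Lemma wmonom_linearl a j l u : linear (fun v => wmonom a ((v, j) :: l) u).
Proof.
move=> c v w; case: l => [|q l] /=; rewrite lact_linearl.
  by rewrite ract_linearl.
by rewrite wmul_linearl.
Qed.

Lemma wmonom_linearr a p l : linear (wmonom a (p :: l)).
Proof.
move=> c u w; elim: l p => [|q l IHl] p; first exact: ract_linearr.
by rewrite !wmonom_cons IHl wmul_linearr.
Qed.

Lemma weval_gword a v j s u :
  weval a (gword v j s u) = wmonom a ((v, j) :: word_coeffs s) u.
Proof.
move: v; apply: ut2_ext => [c x y|c x y|e].
- by rewrite gword_linearl weval_is_linear.
- exact: wmonom_linearl.
move: u; apply: ut2_ext => [c x y|c x y|d].
- by rewrite gword_linearr weval_is_linear.
- exact: wmonom_linearr.
by rewrite -base_wordE /weval lext_base.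
Qed.

Lemma weval_wvar a i : weval a (wvar F i) = a i.
Proof. by rewrite /weval lext_base /= lact1 ract1. Qed.

Lemma weval_lact a w f : weval a (lact w f) = lact w (weval a f).
Proof.
move: f; apply: wfree_ext_gword => [| |v j s u].
- exact: (linear_comp (weval_is_linear a) (lact_linearr w)).
- exact: (linear_comp (lact_linearr w) (weval_is_linear a)).
have -> : lact w (gword v j s u) = gword (w * v) j s u by exact: wfree_lactE.
by rewrite !weval_gword lact_wmonom.
Qed.

Lemma weval_ract a f w : weval a (ract f w) = ract (weval a f) w.
Proof.
move: f; apply: wfree_ext_gword => [| |v j s u].
- exact: (linear_comp (weval_is_linear a) (ract_linearl w)).
- exact: (linear_comp (ract_linearl w) (weval_is_linear a)).
have -> : ract (gword v j s u) w = gword v j s (u * w) by exact: wfree_ractE.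
by rewrite !weval_gword ract_wmonom.
Qed.

Lemma wmonom_linear_mid a p l j l' u :
  linear (fun v => wmonom a (p :: l ++ (v, j) :: l') u).
Proof.
have E v : wmonom a (p :: l ++ (v, j) :: l') u =
    wmul (wmonom a (p :: l) 1) (wmonom a ((v, j) :: l') u).
  by rewrite wmul_wmonom mul1r.
move=> c v w; rewrite !E.
exact: (linear_comp (wmul_linearr _) (wmonom_linearl a j l' u)).
Qed.

Lemma weval_mul a f g : weval a (wmul f g) = wmul (weval a f) (weval a g).
Proof.
move: f; apply: wfree_ext_gword => [| |v j s u].
- exact: (linear_comp (weval_is_linear a) (wmul_linearl g)).
- exact: (linear_comp (wmul_linearl (weval a g)) (weval_is_linear a)).
move: g; apply: wfree_ext_gword => [| |v' j' s' u'].
- exact: (linear_comp (weval_is_linear a) (wmul_linearr _)).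
- exact: (linear_comp (wmul_linearr _) (weval_is_linear a)).
transitivity (weval a
    (\sum_e wcoord e (u * v') *: gword v j (s ++ (e, j') :: s') u')).
  by congr weval; exact: wfree_mulE.
transitivity (\sum_e wcoord e (u * v') *:
    weval a (gword v j (s ++ (e, j') :: s') u')).
  exact: (linear_lc _ _ _ (weval_is_linear a)).
transitivity (wmul (wmonom a ((v, j) :: word_coeffs s) u)
    (wmonom a ((v', j') :: word_coeffs s') u')); last first.
  by congr wmul; exact/esym/weval_gword.
rewrite wmul_wmonom -[in RHS](wcoordK (u * v')).
transitivity (\sum_e wcoord e (u * v') *:
    wmonom a ((v, j) :: word_coeffs s ++ (wbase F e, j') :: word_coeffs s') u').
  apply: eq_bigr => e _; congr (_ *: _); rewrite weval_gword.
  by congr (wmonom a (_ :: _) _); exact: map_cat.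
exact/esym/(linear_lc _ _ _ (wmonom_linear_mid a _ _ _ _ _)).
Qed.

End Evaluation.

Lemma base_word_wmonom (F : fieldType) c j s d :
  base_word F (c, j, s, d) =
  wmonom (wvar F) (word_coeffs F ((c, j) :: s)) (wbase F d).
Proof.
have var_gword v i u : gword v i [::] u = ract (lact v (wvar F i)) u.
  rewrite /wvar base_wordE [lact _ _]wfree_lactE [ract _ _]wfree_ractE.
  by rewrite [wbase F ord0]/(1 : ut2 F) mulr1 mul1r.
elim: s c j => [|[e k] s IHs] c j; first by rewrite base_wordE var_gword.
rewrite [RHS](_ : _ = wmul (lact (wbase F c) (wvar F j))
  (wmonom (wvar F) (word_coeffs F ((e, k) :: s)) (wbase F d))) // -IHs.
transitivity (wmul (gword (wbase F c) j [::] 1)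
    (gword (wbase F e) k s (wbase F d))); last first.
  by congr wmul; [rewrite var_gword ract1 | rewrite base_wordE].
transitivity (\sum_i wcoord i (1 * wbase F e) *:
    gword (wbase F c) j ((i, k) :: s) (wbase F d)); last first.
  exact/esym/wfree_mulE.
rewrite mul1r (bigD1 e) // wcoord_base eqxx scale1r base_wordE big1.
  exact/esym/addr0.
by move=> i /negPf ne; rewrite wcoord_base ne scale0r.
Qed.

Lemma weval_unique (F : fieldType) (A : walgType F) (a : nat -> A)
    (g : wfree F -> A) :
  linear g -> {morph g : x y / wmul x y} ->
  (forall w, {morph g : x / lact w x}) -> (forall w, {morph g : x / ract x w}) ->
  (forall i, g (wvar F i) = a i) -> forall f, g f = weval a f.
Proof.
move=> lg gM gl gr gX; apply: wfree_ext => // [|[[[c j] s] d]].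
  exact: weval_is_linear.
rewrite [RHS]lext_base base_word_wmonom; move: (c, j) => p.
elim: s p => [|q s IHs] p; first by rewrite /= gr gl gX.
by rewrite [LHS](gM _ (wmonom _ (word_coeffs F (q :: s)) _)) IHs gl gX.
Qed.

Section Varieties.
Variable F : fieldType.
Implicit Types (A B : walgType F) (V : walgType F -> Prop).

Definition GId A : set (wfree F) := [set f | forall a : nat -> A, weval a f = 0].

Definition lin_span (E : lmodType F) (S : set E) : set E :=
  [set f | exists r : seq (F * E),
    (forall p, p \in r -> S p.2) /\ f = \sum_(p <- r) p.1 *: p.2].

(* The variables [x_1, ..., x_n] are [wvar F 0, ..., wvar F n.-1]. *)
Definition gmultilinear n (s : 'S_n) (w : 'I_n.+1 -> ut2 F) : wfree F :=
  wmonom (wvar F) [seq (w (widen_ord (leqnSn n) i), val (s i)) | i <- enum 'I_n]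
    (w ord_max).

Definition GP n : set (wfree F) :=
  lin_span [set f | exists s w, f = @gmultilinear n s w].

(* [d] is the dimension of [P / U], for subspaces [U `<=` P]. *)
Definition has_quot_dim (E : lmodType F) (P U : set E) (d : nat) : Prop :=
  exists e : 'I_d -> E,
    [/\ forall i, P (e i),
        forall c : 'I_d -> F, U (\sum_i c i *: e i) -> forall i, c i = 0 &
        forall f, P f -> exists c : 'I_d -> F, U (f - \sum_i c i *: e i)].

(* The default value [0] is relevant only for an infinite-dimensional quotient;
   it does not occur below since [GP n] is finite-dimensional. *)
Definition quot_dim (E : lmodType F) (P U : set E) : nat :=
  xget 0%N (has_quot_dim P U).

(* Classes of [UT_2]-algebras are predicates, since [walgType F] is too large
   to be the base type of a [set]. *)
Definition gvar A : walgType F -> Prop := fun B => GId A `<=` GId B.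

Definition GIdV V : set (wfree F) := [set f | forall B, V B -> GId B f].

Lemma GIdV_gvar A : GIdV (gvar A) = GId A.
Proof. by apply/seteqP; split=> [f|f fA B]; [apply | apply]. Qed.

Definition gc V n : nat := quot_dim (GP n) (GP n `&` GIdV V).

Definition polynomial_growth V : Prop :=
  exists c k : nat, forall n, (0 < n)%N -> (gc V n <= c * n ^ k)%N.

Definition proper_subclass (U V : walgType F -> Prop) : Prop :=
  (forall B, U B -> V B) /\ ~ (forall B, V B -> U B).

Definition almost_polynomial_growth V : Prop :=
  ~ polynomial_growth V /\
  forall B, proper_subclass (gvar B) V -> polynomial_growth (gvar B).

End Varieties.

(* Main.v *)
Require Import Defs.
From HB Require Import structures.
From mathcomp Require Import all_boot all_algebra perm zify ring.
From mathcomp Require Import boolp classical_sets.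
Import GRing.Theory.
Local Open Scope ring_scope.

Set Implicit Arguments.
Unset Strict Implicit.
Unset Printing Implicit Defensive.
(* A proper subvariety of exponential growth is generated by [dut2]: the algebra
   [UT_2] on which [w] acts as its diagonal part. If [f] is an identity of the
   [W]-algebra [UT_2], it is one of [dut2], because the value of [f] at [a] in
   [dut2] is [x - x' + diag x], where [x] and [x'] are the values of [f] in
   [UT_2] at [a] and at the diagonal part of [a]: the difference keeps the
   (1,2)-terms that are linear in the (1,2)-entries of [a] and drops those
   created by [e_12]. The inclusion is proper since [e_12 x] vanishes on [dut2].
   For a set [S] of variables let [f_S] be the monomial listing [S] in order,
   then [x_0], then the complement of [S]. At [x_0 = e_12], [x_i = e_11] for
   [i] in [T], and [x_i = e_22] otherwise, [f_S] is [e_12] if [S = T] and [0] if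
   not; hence the [2^n] monomials [f_S] are independent modulo [GId dut2]. *)

(** * Lower bounds for dimensions of quotients *)

Section QuotientDimension.
Variables (F : fieldType) (E : lmodType F) (U : set E).
Hypotheses (U0 : U 0) (U_lin : forall a x y, U x -> U y -> U (a *: x + y)).

Definition indep_mod d (e : 'I_d -> E) : Prop :=
  forall c : 'I_d -> F, U (\sum_i c i *: e i) -> forall i, c i = 0.

Lemma mod_sum (I : Type) (r : seq I) (c : I -> F) (e : I -> E) :
  (forall i, U (e i)) -> U (\sum_(i <- r) c i *: e i).
Proof.
by move=> Ue; elim: r => [|i r IHr]; rewrite ?big_nil // big_cons; apply: U_lin.
Qed.

(** Steinitz bound modulo [U]: with more vectors [e j] than generators [g i], the coefficient matrix
    has a nonzero row vector in its left kernel, which is a nontrivial relation between the [e j]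
    modulo [U]. *)
Lemma indep_mod_leq m (I : finType) (e : 'I_m -> E) (g : I -> E) :
  indep_mod e ->
  (forall j, exists c : I -> F, U (e j - \sum_i c i *: g i)) -> (m <= #|I|)%N.
Proof.
move=> ind /choice[c ec]; rewrite leqNgt; apply/negP=> lt_dm.
pose C : 'M[F]_(m, #|I|) := \matrix_(j, i) c j (enum_val i).
have : kermx C != 0.
  rewrite kermx_eq0 /row_free; apply/eqP=> rC.
  by have := rank_leq_col C; rewrite rC leqNgt lt_dm.
case/rowV0Pn=> u /sub_kermxP uC /rV0Pn[j]; apply/negP; rewrite negbK; apply/eqP.
(* Weight the memberships [ec j] by the entries of [u]; the [g]-part then cancels because
   [u *m C = 0]. *)
apply: (ind (u 0)); have := mod_sum (index_enum _) (u 0) ec.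
congr U; under eq_bigr do rewrite scalerBr scaler_sumr.
rewrite sumrB exchange_big [X in _ - X]big1 ?subr0 // => i _.
have /rowP/(_ (enum_rank i)) := uC; rewrite !mxE => uC0.
under eq_bigr do rewrite scalerA; rewrite -scaler_suml.
transitivity (0 *: g i); last exact: scale0r.
congr (_ *: _); rewrite -[RHS]uC0.
by apply: eq_bigr => k _; rewrite mxE enum_rankK.
Qed.

(** The finite family [g] bounds the size of independent families in [P], so a largest one exists
    and is a basis modulo [U]. Hence [quot_dim] is a genuine dimension and not the default value of
    [xget]. *)
Lemma quot_dim_ge (P : set E) (I : finType) (g : I -> E) m (e : 'I_m -> E) :
  (forall f, P f -> exists c : I -> F, f = \sum_i c i *: g i) ->
  (forall i, P (e i)) -> indep_mod e -> (m <= quot_dim P U)%N.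
Proof.
move=> Pg Pe ind_e.
pose Q k := `[< exists f : 'I_k -> E, (forall i, P (f i)) /\ indep_mod f >].
have Qm : Q m by apply/asboolP; exists e.
have Qle k : Q k -> (k <= #|I|)%N.
  move=> /asboolP[f [Pf ind_f]]; apply: (indep_mod_leq (g := g) ind_f) => j.
  by have [c ->] := Pg _ (Pf j); exists c; rewrite subrr.
have exQ : exists k, Q k by exists m.
case: (ex_maxnP exQ Qle) => d /asboolP[f [Pf ind_f]] maxd.
have dimd : has_quot_dim P U d.
  exists f; split=> // h Ph.
  (* The maximal family with [h] put in front, which must be dependent. *)
  pose h' (i : 'I_d.+1) := oapp f h (unlift ord0 i).
  have : ~ indep_mod h'.
    move=> ind_h; suff /maxd : Q d.+1 by rewrite ltnn.
    apply/asboolP; exists h'; split=> // i.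
    by rewrite /h'; case: (unlift _ _).
  move=> /existsNP[c] /not_implyP[Uc] /existsNP[i ci].
  move: Uc; rewrite big_ord_recl {1}/h' unlift_none /=.
  under eq_bigr do rewrite /h' liftK /=.
  (* If [h] has coefficient zero, the relation contradicts the independence of [f]; otherwise it is
     solved for [h]. *)
  move=> Uc; have [c0|c0] := eqVneq (c ord0) 0.
    case: ci; case: (unliftP ord0 i) => [j|] -> //.
    by move: Uc; rewrite c0 scale0r add0r => /ind_f.
  exists (fun i => - (c ord0)^-1 * c (lift ord0 i)).
  have := U_lin (c ord0)^-1 Uc U0; congr U.
  rewrite addr0 scalerDr scalerA mulVf // scale1r; congr (_ + _).
  rewrite scaler_sumr -sumrN; apply: eq_bigr => j _.
  by rewrite mulNr scaleNr opprK scalerA.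
(* [xget] need not return this [d], but the value it returns comes with a family that generates [P]
   modulo [U]. *)
have [h [Ph ind_h genh]] := xgetPex 0%N (ex_intro _ d dimd).
rewrite -[quot_dim P U]card_ord; apply: (indep_mod_leq (g := h) ind_e) => j.
exact: genh.
Qed.

End QuotientDimension.

(** * Linear spans *)

Lemma lin_span_linear (F : fieldType) (E : lmodType F) (S : set E) a x y :
  lin_span S x -> lin_span S y -> lin_span S (a *: x + y).
Proof.
move=> [r [Sr ->]] [r' [Sr' ->]].
exists ([seq (a * p.1, p.2) | p <- r] ++ r'); split.
  by move=> p; rewrite mem_cat => /orP[/mapP[q qr ->]|]; [exact: (Sr q) | exact: Sr'].
rewrite big_cat big_map /= scaler_sumr; congr (_ + _).
by apply: eq_bigr => p _; rewrite scalerA.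
Qed.

Lemma lin_span_sub (F : fieldType) (E : lmodType F) (S : set E) x :
  S x -> lin_span S x.
Proof.
move=> Sx; exists [:: (1, x)]; split=> [p|]; first by rewrite inE => /eqP ->.
by rewrite big_seq1 scale1r.
Qed.

Lemma lin_span_sum (F : fieldType) (E : lmodType F) (S : set E) (I : finType)
    (g : I -> E) :
  (forall f, S f -> exists c : I -> F, f = \sum_i c i *: g i) ->
  forall f, lin_span S f -> exists c : I -> F, f = \sum_i c i *: g i.
Proof.
move=> Sg f [r [Sr ->]]; elim: r Sr => [|p r IHr] Sr.
  by exists (fun=> 0); rewrite big_nil big1 // => i _; rewrite scale0r.
have [c pc] : exists c : I -> F, p.2 = \sum_i c i *: g i.
  by apply/Sg/Sr; rewrite mem_head.
rewrite big_cons pc; case: IHr => [q qr|c' ->].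
  by apply: Sr; rewrite in_cons qr orbT.
exists (fun i => p.1 * c i + c' i); rewrite scaler_sumr -big_split.
by apply: eq_bigr => i _; rewrite scalerDl scalerA.
Qed.

(** * Finite dimension of the multilinear spaces *)

Section Monomials.
Variable F : fieldType.

Lemma weval_wmonom (A : walgType F) (a : nat -> A) p l u :
  weval a (wmonom (wvar F) (p :: l) u) = wmonom a (p :: l) u.
Proof.
elim: l p => [|q l IHl] p; first by rewrite weval_ract weval_lact weval_wvar.
by rewrite !wmonom_cons weval_mul weval_lact weval_wvar IHl.
Qed.

(** Every coefficient is expanded in [wbase], one index per coefficient. The generators depend on
    [l] only through its variables, so one index type serves all monomials of a given length. *)
Lemma wmonom_span (A : walgType F) (a : nat -> A) n :
  exists (I : finType) (g : seq nat -> I -> A), forall l u, size l = n.+1 ->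
    exists c : I -> F, wmonom a l u = \sum_i c i *: g (unzip2 l) i.
Proof.
elim: n => [|n [I [g gP]]].
  exists ('I_3 * 'I_3)%type, (fun js i =>
    ract (lact (wbase F i.1) (a (head 0%N js))) (wbase F i.2)).
  move=> [|[v j] [|//]] u // _.
  exists (fun i => wcoord i.1 v * wcoord i.2 u) => /=.
  rewrite -[in LHS](wcoordK v) (linear_lc _ _ _ (lact_linearl _)).
  rewrite (linear_lc _ _ _ (ract_linearl _)).
  rewrite -(pair_bigA _ (fun i k => (wcoord i v * wcoord k u) *:
    ract (lact (wbase F i) (a j)) (wbase F k))) /=.
  apply: eq_bigr => i _.
  rewrite -[in LHS](wcoordK u) (linear_lc _ _ _ (ract_linearr _)) scaler_sumr.
  by apply: eq_bigr => k _; rewrite scalerA.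
exists ('I_3 * I)%type, (fun js i =>
  wmul (lact (wbase F i.1) (a (head 0%N js))) (g (behead js) i.2)).
move=> [|[v j] [|q l]] u // [sz_l].
have [c cE] := gP (q :: l) u (congr1 S sz_l).
exists (fun i => wcoord i.1 v * c i.2); rewrite wmonom_cons cE /=.
rewrite -[in LHS](wcoordK v) (linear_lc _ _ _ (lact_linearl _)).
rewrite (linear_lc _ _ _ (wmul_linearl _)).
rewrite -(pair_bigA _ (fun i k => (wcoord i v * c k) *:
  wmul (lact (wbase F i) (a j)) (g (q.2 :: unzip2 l) k))) /=.
apply: eq_bigr => i _.
rewrite (linear_lc _ _ _ (wmul_linearr _)) scaler_sumr.
by apply: eq_bigr => k _; rewrite scalerA.
Qed.

Lemma GP_fin_dim n : exists (I : finType) (g : I -> wfree F),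
  forall f, @GP F n.+1 f -> exists c : I -> F, f = \sum_i c i *: g i.
Proof.
have [I [g gP]] := wmonom_span (wvar F) n.
pose js (s : 'S_n.+1) := [seq val (s i) | i <- enum 'I_n.+1].
exists ('S_n.+1 * I)%type, (fun i => g (js i.1) i.2).
apply: lin_span_sum => f [s [w ->]]; rewrite /gmultilinear.
set l := map _ _; have [|c ->] := gP l (w ord_max).
  by rewrite size_map size_enum_ord.
(* Only the generators attached to the permutation [s] contribute. *)
exists (fun i => (i.1 == s)%:R * c i.2).
rewrite -(pair_bigA _ (fun i k => ((i == s)%:R * c k) *: g (js i) k)) /=.
rewrite (bigD1 s) //= [X in _ + X]big1 ?addr0 => [|t /negPf nts]; last first.
  by apply: big1 => i _; rewrite nts mul0r scale0r.
rewrite /l /unzip2 -map_comp; apply: eq_bigr => i _.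
by rewrite eqxx mul1r.
Qed.

End Monomials.

(** * The algebra [dut2] *)

Section DiagonalAction.
Variable F : fieldType.
Implicit Types (u v w : ut2 F).

Definition ul u : F := u 0 0.
Definition ur u : F := u 0 1.
Definition lr u : F := u 1 1.

Lemma ut2_eqP u v : ul u = ul v -> ur u = ur v -> lr u = lr v -> u = v.
Proof.
move=> e00 e01 e11; apply/val_inj/matrixP=> i j /=.
have ord2 (k : 'I_2) : k = 0 \/ k = 1.
  by case: k => [[|[|]]] // ?; [left|right]; apply/val_inj.
have [-> | ->] := ord2 i; have [-> | ->] // := ord2 j.
by rewrite (eqP (ut2P u)) (eqP (ut2P v)).
Qed.

Lemma entryD u v : (ul (u + v) = ul u + ul v) * (ur (u + v) = ur u + ur v)
  * (lr (u + v) = lr u + lr v).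
Proof. by rewrite /ul /ur /lr /= !mxE. Qed.

Lemma entryN u : (ul (- u) = - ul u) * (ur (- u) = - ur u) * (lr (- u) = - lr u).
Proof. by rewrite /ul /ur /lr /= !mxE. Qed.

Lemma entryZ a u : (ul (a *: u) = a * ul u) * (ur (a *: u) = a * ur u)
  * (lr (a *: u) = a * lr u).
Proof. by rewrite /ul /ur /lr /= !mxE. Qed.

Lemma entry0 : (ul 0 = 0) * (ur 0 = 0) * (lr 0 = 0).
Proof. by rewrite /ul /ur /lr /= !mxE. Qed.

Lemma entryM u v : (ul (u * v) = ul u * ul v)
  * (ur (u * v) = ul u * ur v + ur u * lr v) * (lr (u * v) = lr u * lr v).
Proof.
rewrite /ul /ur /lr /= !mxE !big_ord_recl !big_ord0.
rewrite [lift _ _](_ : _ = 1); last exact/val_inj.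
by rewrite (eqP (ut2P u)) (eqP (ut2P v)) mulr0 mul0r !addr0 add0r.
Qed.

Lemma entry1 : (ul 1 = 1) * (ur 1 = 0) * (lr 1 = 1).
Proof. by rewrite /ul /ur /lr /= !mxE. Qed.

Lemma entry_e12 : (ul (e12 F) = 0) * (ur (e12 F) = 1) * (lr (e12 F) = 0).
Proof. by rewrite /ul /ur /lr /= !mxE. Qed.

Lemma entry_e22 : (ul (e22 F) = 0) * (ur (e22 F) = 0) * (lr (e22 F) = 1).
Proof. by rewrite /ul /ur /lr /= !mxE. Qed.

(** Here [1 - e22] is $e_{11}$. This is the projection along the ideal $F e_{12}$, hence an algebra
    morphism. *)
Definition ut2_diag w : ut2 F := ul w *: (1 - e22 F) + lr w *: e22 F.

Lemma entry_diag w :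
  (ul (ut2_diag w) = ul w) * (ur (ut2_diag w) = 0) * (lr (ut2_diag w) = lr w).
Proof.
rewrite /ut2_diag !(entryD, entryZ, entryN, entry1, entry_e22).
by rewrite !(subrr, subr0, mulr0, mulr1, addr0, add0r).
Qed.

Opaque ul ur lr ut2_diag.

Definition entryE := (entry_diag, entryM, entryD, entryN, entryZ, entry1,
  entry_e12, entry_e22).

Lemma ut2_diag_is_linear : linear ut2_diag.
Proof. by move=> a u v; apply: ut2_eqP; rewrite !entryE // mulr0 addr0. Qed.

Lemma ut2_diag1 : ut2_diag 1 = 1.
Proof. by apply: ut2_eqP; rewrite !entryE. Qed.

Lemma ut2_diagM u v : ut2_diag (u * v) = ut2_diag u * ut2_diag v.
Proof. by apply: ut2_eqP; rewrite !entryE // mulr0 mul0r addr0. Qed.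

(* [UT_2] as an algebra on which [W] acts through [W / F e_12], identified with
   the diagonal subalgebra of [W]. *)
Definition dut2 : Type := ut2 F.

HB.instance Definition _ := GRing.Lmodule.on dut2.

Definition dut2_mul (a b : dut2) : dut2 := (a : ut2 F) * (b : ut2 F).
Definition dut2_lact w (a : dut2) : dut2 := ut2_diag w * (a : ut2 F).
Definition dut2_ract (a : dut2) w : dut2 := (a : ut2 F) * ut2_diag w.

Fact dut2_mul_linearr a : linear (dut2_mul a).
Proof. exact: ut2_mul_linearr. Qed.

Fact dut2_mul_linearl a : linear (dut2_mul ^~ a).
Proof. exact: ut2_mul_linearl. Qed.

Fact dut2_lact_linearr w : linear (dut2_lact w).
Proof. exact: ut2_mul_linearr. Qed.

Fact dut2_lact_linearl a : linear (dut2_lact ^~ a).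
Proof. exact: (linear_comp (ut2_mul_linearl a) ut2_diag_is_linear). Qed.

Fact dut2_ract_linearl w : linear (dut2_ract ^~ w).
Proof. exact: ut2_mul_linearl. Qed.

Fact dut2_ract_linearr a : linear (dut2_ract a).
Proof. exact: (linear_comp (ut2_mul_linearr a) ut2_diag_is_linear). Qed.

Fact dut2_mulA : associative dut2_mul.
Proof. exact: (@mulrA (ut2 F)). Qed.

Fact dut2_lact1 a : dut2_lact 1 a = a.
Proof. by rewrite /dut2_lact ut2_diag1 mul1r. Qed.

Fact dut2_ract1 a : dut2_ract a 1 = a.
Proof. by rewrite /dut2_ract ut2_diag1 mulr1. Qed.

Fact dut2_lactM u v a : dut2_lact (u * v) a = dut2_lact u (dut2_lact v a).
Proof. by rewrite /dut2_lact ut2_diagM mulrA. Qed.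

Fact dut2_ractM a u v : dut2_ract a (u * v) = dut2_ract (dut2_ract a u) v.
Proof. by rewrite /dut2_ract ut2_diagM mulrA. Qed.

Fact dut2_lractA u a v : dut2_ract (dut2_lact u a) v = dut2_lact u (dut2_ract a v).
Proof. by rewrite /dut2_ract /dut2_lact mulrA. Qed.

Fact dut2_lact_mul u a b : dut2_lact u (dut2_mul a b) = dut2_mul (dut2_lact u a) b.
Proof. exact: (@mulrA (ut2 F)). Qed.

Fact dut2_ract_mul a b u : dut2_ract (dut2_mul a b) u = dut2_mul a (dut2_ract b u).
Proof. exact/esym/(@mulrA (ut2 F)). Qed.

Fact dut2_mul_ract_lact a u b :
  dut2_mul (dut2_ract a u) b = dut2_mul a (dut2_lact u b).
Proof. exact/esym/(@mulrA (ut2 F)). Qed.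

HB.instance Definition _ := Lmodule_isWAlgebra.Build F dut2
  dut2_mul_linearr dut2_mul_linearl dut2_mulA
  dut2_lact_linearr dut2_lact_linearl dut2_ract_linearl dut2_ract_linearr
  dut2_lact1 dut2_ract1 dut2_lactM dut2_ractM dut2_lractA
  dut2_lact_mul dut2_ract_mul dut2_mul_ract_lact.

(** * Evaluation in [dut2] through evaluations in [ut2] *)

Lemma ut2_diagK u : ut2_diag (ut2_diag u) = ut2_diag u.
Proof. by apply: ut2_eqP; rewrite !entryE. Qed.

Lemma weval_diag (a : nat -> ut2 F) f :
  ut2_diag (weval (ut2_diag \o a) f) = ut2_diag (weval a f).
Proof.
move: f; apply: wfree_ext => [| |t].
- exact: (linear_comp ut2_diag_is_linear (weval_is_linear _)).
- exact: (linear_comp ut2_diag_is_linear (weval_is_linear _)).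
case: t => -[p s] d; rewrite /weval !lext_base.
elim: s p => [|q s IHs] p; first by rewrite /= !ut2_diagM ut2_diagK.
rewrite /word_coeffs map_cons map_cons.
rewrite !wmonom_cons !ut2_diagM /= ut2_diagK.
by congr (_ * _); apply: IHs.
Qed.

(* On pairs with equal diagonals, [degen] is a morphism onto [dut2] for the
   componentwise operations. *)
Definition degen u v : dut2 := u - v + ut2_diag u.

Lemma entry_degen u v : (ul (degen u v) = ul u - ul v + ul u)
  * (ur (degen u v) = ur u - ur v) * (lr (degen u v) = lr u - lr v + lr u).
Proof. by rewrite /degen !(entryD, entryN, entry_diag) addr0. Qed.

Lemma ut2_diag_eq u v : ut2_diag u = ut2_diag v -> ul u = ul v /\ lr u = lr v.
Proof. by move=> uv; rewrite -!(entry_diag u) uv !entry_diag. Qed.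

Lemma degen_lin a u v u' v' :
  degen (a *: u + u') (a *: v + v') = a *: degen u v + degen u' v'.
Proof.
by apply: ut2_eqP; rewrite !(entryD, entryZ, entry_degen); ring.
Qed.

(** With common diagonals, the (1,2)-entries of the two products differ by [ul u * (ur u' - ur v') +
    (ur u - ur v) * lr u'], which is the (1,2)-entry of the product of the two [degen] values. *)
Lemma degenM u v u' v' : ut2_diag v = ut2_diag u -> ut2_diag v' = ut2_diag u' ->
  degen (wmul u u') (wmul v v') = wmul (degen u v) (degen u' v').
Proof.
move=> uv uv'; have [ulE lrE] := ut2_diag_eq uv; have [ulE' lrE'] := ut2_diag_eq uv'.
change (degen (u * u') (v * v') = (degen u v : ut2 F) * (degen u' v' : ut2 F)).
by apply: ut2_eqP; rewrite !(entryM, entry_degen) ?ulE ?lrE ?ulE' ?lrE'; ring.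
Qed.

(** The term [ur w * lr u] in the (1,2)-entry of [w * u] cancels against [ur w * lr v], so only the
    diagonal of [w] survives. *)
Lemma degen_lact w u v : ut2_diag v = ut2_diag u ->
  degen (lact w u) (lact w v) = lact w (degen u v).
Proof.
move=> /ut2_diag_eq[ulE lrE].
change (degen (w * u) (w * v) = ut2_diag w * (degen u v : ut2 F)).
by apply: ut2_eqP; rewrite !(entryM, entry_degen, entry_diag) ?ulE ?lrE; ring.
Qed.

Lemma degen_ract u v w : ut2_diag v = ut2_diag u ->
  degen (ract u w) (ract v w) = ract (degen u v) w.
Proof.
move=> /ut2_diag_eq[ulE lrE].
change (degen (u * w) (v * w) = (degen u v : ut2 F) * ut2_diag w).
by apply: ut2_eqP; rewrite !(entryM, entry_degen, entry_diag) ?ulE ?lrE; ring.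
Qed.

(** By [weval_unique], it suffices that the right-hand side is a morphism into [dut2] with the
    correct values on variables; [weval_diag] supplies the equal diagonals required by the [degen]
    lemmas. *)
Lemma weval_dut2 (a : nat -> ut2 F) f :
  weval (a : nat -> dut2) f = degen (weval a f) (weval (ut2_diag \o a) f).
Proof.
apply/esym; move: f; apply: weval_unique => [c x y|x y|w x|w x|i].
- by rewrite !weval_is_linear degen_lin.
- by rewrite 2!weval_mul; apply: degenM; exact: weval_diag.
- by rewrite 2!weval_lact; apply: degen_lact; exact: weval_diag.
- by rewrite 2!weval_ract; apply: degen_ract; exact: weval_diag.
- rewrite !weval_wvar /degen; apply: ut2_eqP => /=.
  + by rewrite !(entryD, entryN, entry_diag) subrr add0r.
  + by rewrite !(entryD, entryN, entry_diag) subr0 addr0.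
  + by rewrite !(entryD, entryN, entry_diag) subrr add0r.
Qed.

End DiagonalAction.

(** * Monomials indexed by subsets *)

Section SubsetWords.
Variables (F : fieldType) (n : nat).
Implicit Types S T : {set 'I_n}.

Definition subset_word S : seq 'I_n.+1 :=
  [seq lift ord0 i | i <- enum S] ++ ord0 :: [seq lift ord0 i | i <- enum (~: S)].

(** Gives the subset words the form in which [gmultilinear] takes its variables. *)
Lemma subset_word_perm S :
  exists s : 'S_n.+1, [seq s i | i <- enum 'I_n.+1] = subset_word S.
Proof.
have inj0 := @lift_inj _ (@ord0 n).
have sz : size (subset_word S) == n.+1.
  rewrite size_cat /= !size_map -!cardE addnS.
  by have := finset.cardsC S; rewrite card_ord => ->.
have /tuple_permP[s sE] : perm_eq (Tuple sz) (ord_tuple n.+1).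
  rewrite val_ord_tuple; apply: uniq_perm; rewrite ?enum_uniq //=.
    rewrite cat_uniq /= !map_inj_uniq // !enum_uniq andbT /=.
    apply/andP; split; last by apply/mapP=> -[i _ /eqP]; rewrite -val_eqE.
    rewrite negb_or; apply/andP; split.
      by apply/mapP=> -[i _ /eqP]; rewrite -val_eqE.
    apply/hasPn=> _ /mapP[i + ->]; rewrite mem_enum inE.
    by apply: contra => /mapP[j + /inj0 ->]; rewrite mem_enum.
  move=> i; rewrite mem_enum inE mem_cat in_cons.
  case: (unliftP ord0 i) => [j|] ->; last by rewrite eqxx orbT.
  by rewrite !mem_map // !mem_enum inE; case: (j \in S); rewrite ?orbT.
exists s; rewrite -[RHS]/(tval (Tuple sz)) sE /=.
by apply: eq_map => i; rewrite tnth_ord_tuple.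
Qed.

(** The shift by one matches [lift ord0]: an element [i] of ['I_n] labels the variable of index
    [i.+1], and index 0 is the separator. *)
Definition subset_subst T (k : nat) : ut2 F :=
  if k is k'.+1 then
    if [exists i in T, val i == k'] then 1 - e22 F else e22 F
  else e12 F.

Lemma subset_subst_lift T (i : 'I_n) :
  subset_subst T (lift ord0 i) = if i \in T then 1 - e22 F else e22 F.
Proof.
rewrite /= /bump /=; congr (if _ then _ else _).
apply/existsP/idP => [[j /andP[jT /eqP/val_inj <-]] // | iT].
by exists i; rewrite iT eqxx.
Qed.

Lemma prod_subset S T : \prod_(i in S) (i \in T)%:R = (S \subset T)%:R :> F.
Proof.
have [/fintype.subsetP ST | /fintype.subsetPn[i iS /negPf iT]] := boolP (S \subset T).
  by apply: big1 => i /ST ->.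
by rewrite (bigD1 i) //= iT mul0r.
Qed.

Lemma ul_prod (I : Type) (r : seq I) (x : I -> ut2 F) :
  ul (\prod_(i <- r) x i) = \prod_(i <- r) ul (x i).
Proof. by apply: (big_morph (@ul F)) => [u v|]; rewrite ?entryM ?entry1. Qed.

Lemma lr_prod (I : Type) (r : seq I) (x : I -> ut2 F) :
  lr (\prod_(i <- r) x i) = \prod_(i <- r) lr (x i).
Proof. by apply: (big_morph (@lr F)) => [u v|]; rewrite ?entryM ?entry1. Qed.

(** The (1,2)-entry of [u * e12 * v] is [ul u * lr v]. The first factor tests whether [S] lies in
    [T], the second whether the complement of [S] lies in that of [T]; together they test
    equality. *)
Lemma ur_subset_word S T :
  ur (\prod_(j <- subset_word S) subset_subst T j) = (S == T)%:R.
Proof.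
rewrite big_cat big_cons /= !(entryM, entry_e12).
rewrite !(mul0r, mulr0, mul1r, add0r, addr0) !big_map ul_prod lr_prod !big_enum.
under eq_bigr => i _.
  rewrite subset_subst_lift (_ : ul _ = (i \in T)%:R); first over.
  by case: ifP => _; rewrite !(entryD, entryN, entry1, entry_e22) ?subr0.
under [X in _ * X]eq_bigr => i _.
  rewrite subset_subst_lift (_ : lr _ = (i \in ~: T)%:R); first over.
  rewrite inE; case: ifP => _; last by rewrite entry_e22.
  by rewrite !(entryD, entryN, entry1, entry_e22) subrr.
rewrite !prod_subset finset.setCS finset.eqEsubset.
by case: (S \subset T); rewrite ?mul1r ?mul0r.
Qed.

Lemma wmonom_dut2 (a : nat -> ut2 F) j (js : seq nat) :
  wmonom (a : nat -> dut2 F) [seq (1, k) | k <- j :: js] 1 =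
  \prod_(k <- j :: js) a k.
Proof.
elim: js j => [|k js IHjs] j; first by rewrite big_seq1 /= lact1 ract1.
rewrite big_cons -IHjs.
by rewrite [LHS]wmonom_cons lact1.
Qed.

Lemma subset_monomial S : exists2 f : wfree F, GP n.+1 f &
  forall T, ur (weval (subset_subst T : nat -> dut2 F) f) = (S == T)%:R.
Proof.
have [s sE] := subset_word_perm S.
exists (gmultilinear s (fun=> 1)); first by apply: lin_span_sub; exists s, (fun=> 1).
move=> T; rewrite -ur_subset_word -sE /gmultilinear big_map.
have -> : [seq ((1 : ut2 F), val (s i)) | i <- enum 'I_n.+1] =
    [seq (1, k) | k <- [seq val (s i) | i <- enum 'I_n.+1]].
  by rewrite -map_comp.
rewrite -(big_map (fun i => val (s i)) xpredT (subset_subst T)).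
case: [seq val (s i) | i <- _] (size_map (fun i => val (s i)) (enum 'I_n.+1)).
  by rewrite size_enum_ord.
move=> j js _; rewrite -wmonom_dut2 map_cons.
by rewrite weval_wmonom.
Qed.

End SubsetWords.

(** * Exponential growth and proper inclusion *)

Lemma GId_lin (F : fieldType) (A : walgType F) c f g :
  GId A f -> GId A g -> GId A (c *: f + g).
Proof. by move=> Af Ag a; rewrite weval_is_linear Af Ag scaler0 addr0. Qed.

Lemma gc_dut2_ge (F : fieldType) n : (2 ^ n <= gc (gvar (dut2 F)) n.+1)%N.
Proof.
rewrite /gc GIdV_gvar.
have [f [fGP fE]] : exists f : {set 'I_n} -> wfree F, (forall S, GP n.+1 (f S)) /\
    forall S T, ur (weval (subset_subst F T : nat -> dut2 F) (f S)) = (S == T)%:R.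
  have /choice[f fP] : forall S : {set 'I_n}, exists g : wfree F, GP n.+1 g /\
      forall T, ur (weval (subset_subst F T : nat -> dut2 F) g) = (S == T)%:R.
    by move=> S; have [g] := subset_monomial F S; exists g.
  by exists f; split=> S; case: (fP S).
have [I [g gP]] := GP_fin_dim F n.
have <- : #|{set 'I_n}| = (2 ^ n)%N by rewrite -cardsT -powersetT card_powerset cardsT card_ord.
apply: (quot_dim_ge _ _ gP (e := fun i => f (enum_val i))) => //.
- split; first by exists [::]; rewrite big_nil.
  by move=> a; exact: (linear0 (lext _)).
- move=> a x y [Px Ux] [Py Uy]; split; first exact: lin_span_linear.
  exact: GId_lin.
move=> c [_ Uc] k.
(* Evaluating the relation at the substitution of the [k]-th subset and taking the (1,2)-entry
   isolates [c k]. *)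
have := congr1 (@ur F) (Uc (subset_subst F (enum_val k))).
rewrite (linear_lc _ _ _ (weval_is_linear _)).
have ur_lin : linear (@ur F : ut2 F -> F^o).
  by move=> a x y; rewrite !(entryD, entryZ).
rewrite (linear_lc (g := @ur F : _ -> F^o) _ _ _ ur_lin) (bigD1 k) //=.
rewrite fE eqxx big1 => [|i nik]; last first.
  by rewrite fE (inj_eq enum_val_inj) (negPf nik) scaler0.
by rewrite addr0 [_ *: _]mulr1 => ->; rewrite entry0.
Qed.

Lemma exp2_not_poly_bounded c k : exists n, (c * n.+1 ^ k < 2 ^ n)%N.
Proof.
(* For $n = 4^j$ the left side is at most $2^{c+(2j+1)k}$. The choice of [j] makes this exponent
   smaller than $(j+1)^2$, which is at most $4^j = n$. *)
pose j := (c + 2 * k)%N; exists (2 ^ (2 * j))%N.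
have le1 : ((2 ^ (2 * j)).+1 <= 2 ^ (2 * j).+1)%N.
  by rewrite expnS; have := expn_gt0 2 (2 * j); lia.
apply: (@leq_ltn_trans (2 ^ (c + (2 * j).+1 * k))).
  rewrite expnD; apply: leq_mul; first exact/ltnW/ltn_expl.
  by case: (k) => [|k']; rewrite ?muln0 // (expnM _ _ k'.+1) leq_exp2r.
rewrite ltn_exp2l //.
have : (j.+1 * j.+1 <= 2 ^ (2 * j))%N.
  by rewrite mul2n -addnn expnD leq_mul // ltn_expl.
by rewrite /j; nia.
Qed.

Lemma GId_ut2_dut2 (F : fieldType) : (GId (ut2 F) `<=` GId (dut2 F))%classic.
Proof.
move=> f Uf a; rewrite (weval_dut2 a f) /degen !Uf subr0 add0r.
by rewrite /ut2_diag !entry0 !scale0r addr0.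
Qed.

Lemma proper_gvar_dut2 (F : fieldType) :
  proper_subclass (gvar (dut2 F)) (gvar (ut2 F)).
Proof.
split=> [B|sub]; first by move=> dB f /GId_ut2_dut2/dB.
have id12 : GId (dut2 F) (lact (e12 F) (wvar F 0)).
  move=> a; rewrite weval_lact weval_wvar.
  have diag0 : ut2_diag (e12 F) = 0.
    by rewrite /ut2_diag !entry_e12 !scale0r addr0.
  change (ut2_diag (e12 F) * (a 0%N : ut2 F) = 0).
  by rewrite diag0 mul0r.
(* The substitution of 1 for all variables sends $e_{12}x_0$ to $e_{12}$ in [ut2]. *)
have := sub (ut2 F) (@subset_refl _ (GId (ut2 F))) _ id12 (fun=> 1).
rewrite weval_lact weval_wvar => e12_0.
have : e12 F * 1 = 0 by exact: e12_0.
rewrite mulr1 => /(congr1 (@ur F)); rewrite entry_e12 entry0 => /eqP.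
by rewrite oner_eq0.
Qed.

Theorem corollary5p3 (F : fieldType) (charF0 : [pchar F] =i pred0) :
  ~ almost_polynomial_growth (gvar (ut2 F)).
Proof.
move=> [_ /(_ _ (@proper_gvar_dut2 F))[c [k bound]]].
have [n lt_n] := exp2_not_poly_bounded c k.
(* Degree [n.+1] because the separator adds one variable to the [n] that the subsets range over. *)
by have := bound n.+1 isT; rewrite leqNgt (leq_trans lt_n) ?gc_dut2_ge.
Qed.
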